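(* Let $\Lambda$ be a group and let $\sim$ be a $\Lambda$-equivariant generalised Morse matching on a finite cubical $\Lambda$-complex $X$. Assume that the critical cells of $\sim$ form a subcomplex $U$. Then the subcomplex $U$ is a $\Lambda$-equivariant strong deformation retract of $X$.
   Context: A cubical $\Lambda$-complex is a cubical complex (the intersection of any two cells is empty or a common face) with an action of $\Lambda$ by automorphisms of the cubical complex. A cubical complex is identified with its poset of (nonempty) cells ordered by the face relation; for cells $\sigma\le\tau$ the interval is $[\sigma,\tau]=\{\alpha\in X\mid\sigma\le\alpha\le\tau\}$. Let $\sim$ be an equivalence relation on the cells of $X$ whose equivalence classes are intervals in $X$. Then $\sim$ is a generalised Morse matching if there is no cycle \[ \sigma_1<\tau_1>\sigma_2<\tau_2>\cdots>\sigma_k<\tau_k>\sigma_{k+1}=\sigma_1 \] with $k\ge 2$ and $\sigma_i\sim\tau_i\not\sim\sigma_{i+1}$ for $1\le i\le k$. A cell is critical if it is alone in its equivalence class. The matching is $\Lambda$-equivariant if $\sigma\sim\tau$ implies $g\sigma\sim g\tau$ for all $g\in\Lambda$. $U$ is a $\Lambda$-equivariant strong deformation retract of $X$ if there is a homotopy $H\colon X\times[0,1]\to X$ from the identity to a retraction onto $U$, fixing $U$ pointwise at all times, with $H(gx,t)=gH(x,t)$ for all $g\in\Lambda$. *)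

(* Defs.v *)
From HB Require Import structures.
From mathcomp Require Import all_boot all_order all_algebra.
From mathcomp Require Import monoid.
From mathcomp Require Import boolp classical_sets functions set_interval reals.
From mathcomp Require Import topology normedtype.
Set Implicit Arguments.
Unset Strict Implicit.
Unset Printing Implicit Defensive.
Import Order.TTheory GRing.Theory Num.Theory.
Import numFieldNormedType.Exports.
Local Open Scope classical_set_scope.
Local Open Scope ring_scope.

(* A nonempty face of the cube [0,1]^n fixes some coordinates to 0 or 1
   ([Some false], [Some true]) and leaves the others free ([None]). *)
Definition cube_face (n : nat) := {ffun 'I_n -> option bool}.

Definition cube_face_le (n : nat) (a b : cube_face n) : bool :=
  [forall i, (b i == None) || (a i == b i)].

Section Cubical.
Context {d : Order.disp_t} {X : finPOrderType d}.
Implicit Types (x y s t : X).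

(* [phi] identifies the faces of the cell [s] with the faces of [0,1]^n;
   its values at cells that are not faces of [s] are irrelevant. *)
Definition cube_chart s (n : nat) (phi : X -> cube_face n) : Prop :=
  (forall x y, (x <= s)%O -> (y <= s)%O ->
     cube_face_le (phi x) (phi y) = (x <= y)%O) /\
  (forall a : cube_face n, exists2 x, (x <= s)%O & phi x = a).

(* Poset of nonempty cells of a (finite) cubical complex: every cell is a cube,
   and the intersection of two cells, a union of common faces, is either empty
   or a single common face. *)
Definition cubical_complex : Prop :=
  (forall s, exists n, exists phi : X -> cube_face n, cube_chart s phi) /\
  (forall s t, (forall x, ~ ((x <= s)%O /\ (x <= t)%O)) \/
     (exists m, forall x, (x <= m)%O <-> (x <= s)%O /\ (x <= t)%O)).

Definition subcomplex (U : set X) : Prop :=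
  forall s t, (s <= t)%O -> U t -> U s.

Definition cell_interval s t : set X := [set x | (s <= x <= t)%O].

Section Realization.
Context {R : realType}.

(* The point of the closed cell [s] with cube coordinates [u] : its coordinate
   at a vertex [v] of [s] is the product of [u i] or [1 - u i] according to
   whether [v] lies on the facet [1] or [0] in direction [i].  These
   multilinear weights embed [0,1]^n in R^(vertices), restrict to the same
   weights on each face, and [u i] is recovered as the total weight of the
   vertices with [i]-th coordinate 1.  Coordinates at cells of positive
   dimension are 0. *)
Definition cube_point s (n : nat) (phi : X -> cube_face n) (u : 'I_n -> R) :
    {ptws X -> R} :=
  fun v => if (v <= s)%O then
             \prod_(i < n) match phi v i with
                           | Some true => u i
                           | Some false => 1 - u i
                           | None => 0
                           end
           else 0.

Definition closed_cell s : set {ptws X -> R} :=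
  [set w | exists n, exists phi : X -> cube_face n, exists u : 'I_n -> R,
     [/\ cube_chart s phi, forall i, 0 <= u i <= 1 & w = cube_point s phi u]].

(* Geometric realization of a set of cells. Two closed cells meet exactly in
   the realization of their common face. *)
Definition realization (A : set X) : set {ptws X -> R} :=
  \bigcup_(s in A) closed_cell s.

End Realization.

Section Action.
Context {L : groupType}.

Definition cubical_action (act : L -> X -> X) : Prop :=
  [/\ forall x, act 1%g x = x,
      forall g h x, act (g * h)%g x = act g (act h x) &
      forall g x y, (act g x <= act g y)%O = (x <= y)%O].

(* The induced action on the realization, which sends the vertex with weight 1
   at [v] to the one at [act g v] and maps cells to cells multilinearly. *)
Definition realized_action {R : realType} (act : L -> X -> X) (g : L)
    (w : {ptws X -> R}) : {ptws X -> R} :=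
  fun v => w (act (g^-1)%g v).

Definition equivariant_rel (act : L -> X -> X) (sim : rel X) : Prop :=
  forall g x y, sim x y -> sim (act g x) (act g y).

End Action.

(* The indices of a cycle of length [k] are taken modulo [k] by [ordS]. *)
Definition gen_morse_matching (sim : rel X) : Prop :=
  [/\ equivalence_rel sim,
      forall x, exists s t, [set y | sim x y] = cell_interval s t &
      ~ exists k : nat, exists s t : 'I_k -> X,
          (2 <= k)%N /\
          forall i, [/\ (s i < t i)%O, (s (ordS i) < t i)%O,
                        sim (s i) (t i) & ~~ sim (t i) (s (ordS i))]].

Definition critical (sim : rel X) : set X :=
  [set x | [set y | sim x y] = [set x]].

End Cubical.
Arguments cubical_complex {d} X.
Arguments realization {d X} R A.

Definition equivariant_strong_deformation_retract (R : realType)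
    (T : topologicalType) (L : Type) (act : L -> T -> T) (A B : set T) : Prop :=
  A `<=` B /\
  exists H : T * R -> T,
    [/\ {within B `*` `[0, 1], continuous H},
        forall x t, B x -> 0 <= t <= 1 -> B (H (x, t)),
        forall x, B x -> H (x, 0) = x /\ A (H (x, 1)),
        forall x t, A x -> 0 <= t <= 1 -> H (x, t) = x &
        forall g x t, B x -> 0 <= t <= 1 -> H (act g x, t) = act g (H (x, t))].

(* Main.v *)
Require Import Defs.
From mathcomp Require Import all_boot all_order all_algebra.
From mathcomp Require Import monoid classical_sets reals topology normedtype.
From mathcomp Require Import boolp ring lra.
Import numFieldNormedType.Exports.

(** The complex is collapsed in stages.  Let [Y] be an invariant subcomplex that
    is a union of classes and contains the critical cells.  If [Y] has a
    noncritical cell, then by acyclicity some noncritical class [[sg, ta]] is free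
    in [Y]: every cell of [Y] above [sg] is below [ta] ([free_class_exists]).
    Removing all the free classes leaves a smaller such subcomplex
    ([collapse_stage]), and the realization of [Y] retracts onto that of the
    smaller one ([retracts_collapse]).  After finitely many stages only the
    critical cells remain, and the homotopies are performed one after the other
    ([retracts_trans]).

    In one stage, each cube [ta] is projected radially from a centre outside it,
    opposite the face [sg], onto the union of its faces that do not contain [sg];
    the homotopy follows the segments in cube coordinates.  The centre is
    symmetric under the automorphisms of the pair [(sg, ta)], which makes the
    construction equivariant even though the stabilizer of [ta] may act
    nontrivially on it.

    The projection is expressed without charts.  The coordinates of a point [w] of
    a cell are its masses [mass w f], the total weight of the vertices of the facet
    [f], and the weight of [w] at a vertex is the product of the masses of the
    facets through it ([closed_cell_spread]).  Facets and masses depend only on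
    the order, so equivariance is a reindexing ([act_displacement]), while
    charts serve only to prove that pushed points stay in the cube ([push_in_cell])
    and end in the right face ([push_end]).  The resulting formula is continuous on
    the whole ambient space and is stationary on the cells that do not contain
    [sg] ([slack_far]), so no gluing of homotopies is involved. *)

Set Implicit Arguments.
Unset Strict Implicit.
Unset Printing Implicit Defensive.
Import Order.TTheory GRing.Theory Num.Theory.
Local Open Scope order_scope.
Local Open Scope classical_set_scope.
Local Open Scope ring_scope.

(** * Charts of a cube and its facets *)

Section Charts.
Context {d : Order.disp_t} {X : finPOrderType d} {R : realType}.
Implicit Types (x y s t v f : X) (w : X -> R).

Definition vertex v := [forall x : X, (x <= v)%O ==> (x == v)].
Definition facet s f :=
  (f < s)%O && [forall x : X, (f <= x <= s)%O ==> (x == f) || (x == s)].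
(** On the realization, [mass w f] for a facet [f] of a cell is the cube
    coordinate of [w] that equals 1 on [f] and 0 on the facet opposite to [f]. *)
Definition mass w f : R := \sum_(v | (v <= f)%O) w v.
(** Chart-free form of [cube_point]: the value [U f] plays the part of [u i] or
    [1 - u i] for the two facets [f] in direction [i].  Being expressed by the
    order alone, it commutes with every automorphism of [X]. *)
Definition spread (U : X -> R) s : X -> R := fun v =>
  if (v <= s)%O && vertex v then \prod_(f | facet s f && (v <= f)%O) U f else 0.

Definition half_cube n (i : 'I_n) (b : bool) : cube_face n :=
  [ffun j => if j == i then Some b else None].

Lemma vertex_eq v x : vertex v -> (x <= v)%O -> x = v.
Proof. by move=> /forallP/(_ x)/implyP h /h/eqP. Qed.

Lemma cube_face_leP n (a b : cube_face n) :
  reflect (forall i, b i = None \/ a i = b i) (cube_face_le a b).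
Proof.
apply: (iffP forallP) => h i.
  by case/orP: (h i) => /eqP; [left|right].
by case: (h i) => ->; rewrite eqxx ?orbT.
Qed.

Section Chart.
Variables (s : X) (n : nat) (phi : X -> cube_face n).
Hypothesis chart : cube_chart s phi.

Lemma chart_le x y : (x <= s)%O -> (y <= s)%O ->
  (x <= y)%O = cube_face_le (phi x) (phi y).
Proof. by case: chart => h _ xs ys; rewrite h. Qed.

Lemma chart_surj a : exists2 x, (x <= s)%O & phi x = a.
Proof. by case: chart => _. Qed.

Lemma chart_inj x y : (x <= s)%O -> (y <= s)%O -> phi x = phi y -> x = y.
Proof.
move=> xs ys e; apply/le_anti; rewrite (chart_le xs ys) (chart_le ys xs) e andbb.
by apply/cube_face_leP; right.
Qed.

Lemma chart_top i : phi s i = None.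
Proof.
pose all_ b : cube_face n := [ffun=> Some b].
have H b : phi s i = None \/ Some b = phi s i.
  have [x xs xE] := chart_surj (all_ b).
  move: (xs); rewrite chart_le // xE => /cube_face_leP/(_ i).
  by rewrite ffunE.
by case: (H true) => // e1; case: (H false) => // e0; move: e1; rewrite -e0.
Qed.

Lemma chart_le_None x y i : (x <= y)%O -> (y <= s)%O ->
  phi x i = None -> phi y i = None.
Proof.
move=> xy ys; have xs := le_trans xy ys.
by move: xy; rewrite chart_le // => /cube_face_leP/(_ i)[//|->].
Qed.

Lemma chart_le_Some x y i b : (x <= y)%O -> (y <= s)%O ->
  phi y i = Some b -> phi x i = Some b.
Proof.
move=> xy ys; have xs := le_trans xy ys.
by move: xy; rewrite chart_le // => /cube_face_leP/(_ i)[->|->].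
Qed.

Lemma le_half_cube x f i b : (x <= s)%O -> (f <= s)%O ->
  phi f = half_cube i b -> (x <= f)%O = (phi x i == Some b).
Proof.
move=> xs fs fE; rewrite chart_le // fE; apply/cube_face_leP/eqP.
  by move=> /(_ i); rewrite ffunE eqxx => -[].
by move=> xE j; rewrite ffunE; case: eqVneq => [->|]; [right|left].
Qed.

Lemma half_cube_ex i b : exists2 f, (f <= s)%O & phi f = half_cube i b.
Proof. exact: chart_surj. Qed.

Lemma chart_vertex v : (v <= s)%O -> vertex v = [forall i, phi v i != None].
Proof.
move=> vs; apply/idP/forallP => [vv i|h].
  apply/eqP => vi.
    pose a : cube_face n := [ffun j => if j == i then Some true else phi v j].
  have [x xs xE] := chart_surj a.
  have xv : (x <= v)%O.
    rewrite chart_le // xE; apply/cube_face_leP => j; rewrite ffunE.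
    by case: eqVneq => [->|]; [left|right].
  have := xE; rewrite (vertex_eq vv xv) => /ffunP/(_ i).
  by rewrite ffunE eqxx vi.
apply/forallP => x; apply/implyP => xv; apply/eqP.
have xs := le_trans xv vs.
apply: chart_inj => //; apply/ffunP => i.
move: xv; rewrite chart_le // => /cube_face_leP/(_ i)[] // e.
by have := h i; rewrite e.
Qed.

Lemma proper_face_axis x : (x < s)%O -> exists i b, phi x i = Some b.
Proof.
move=> lt_xs; have xs := ltW lt_xs.
have [i xi] : exists i, phi x i != None.
  apply/existsP; rewrite -negb_forall; apply/negP => /forallP h.
  have := lt_le_asym x s; rewrite lt_xs /= chart_le //.
  by move/negP; apply; apply/cube_face_leP => i; left; apply/eqP/h.
by case xib: (phi x i) xi => [b|//] _; exists i, b.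
Qed.

Lemma chart_facetP f : reflect ((f <= s)%O /\ exists i b, phi f = half_cube i b)
  (facet s f).
Proof.
apply: (iffP idP) => [/andP[fs /forallP cov]|[fs [i [b fE]]]].
  have fs' := ltW fs; split=> //.
  have [i [b fib]] := proper_face_axis fs; exists i, b.
  have [x xs xE] := half_cube_ex i b.
  have fx : (f <= x)%O by rewrite (le_half_cube fs' xs xE) fib.
  have /orP[/eqP<- //|/eqP xs'] := implyP (cov x) (introT andP (conj fx xs)).
  by have := chart_top i; rewrite -xs' xE ffunE eqxx.
apply/andP; split.
  rewrite lt_neqAle fs andbT; apply/eqP => fs'.
  by have := chart_top i; rewrite -fs' fE ffunE eqxx.
apply/forallP => x; apply/implyP => /andP[fx xs].
case xi: (phi x i) => [c|].
  have xf : (x <= f)%O.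
    rewrite (le_half_cube xs fs fE) xi.
    by move: (chart_le_Some fx xs xi); rewrite fE ffunE eqxx => ->.
  by rewrite eq_le xf fx.
rewrite [x == s]eq_le xs chart_le //; apply/orP; right.
apply/cube_face_leP => j; left.
have [->//|ji] := eqVneq j i.
by apply: (chart_le_None fx xs); rewrite fE ffunE (negPf ji).
Qed.

(** A vertex lies on exactly one facet in each direction, so a product over the
    directions is a product over the facets through that vertex. *)
Lemma prod_facets (U : X -> R) v : (v <= s)%O -> vertex v ->
  forall F : 'I_n -> R,
  (forall i b f, (f <= s)%O -> phi f = half_cube i b -> phi v i = Some b ->
     U f = F i) ->
  \prod_(f | facet s f && (v <= f)%O) U f = \prod_i F i.
Proof.
move=> vs vv F UF.
have vbit i : {b | phi v i = Some b}.
  move: vv; rewrite chart_vertex // => /forallP/(_ i).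
  by case: (phi v i) => // b; exists b.
have hf i := cid2 (half_cube_ex i (sval (vbit i))).
pose h i := s2val (hf i).
have hs i : (h i <= s)%O by rewrite /h; case: (hf i).
have hE i : phi (h i) = half_cube i (sval (vbit i)) by rewrite /h; case: (hf i).
have hinj : injective h.
  move=> i j e; have := hE i; rewrite e hE => /ffunP/(_ i).
  by rewrite !ffunE eqxx; case: eqVneq.
transitivity (\prod_(f in h @: 'I_n) U f).
  apply: eq_bigl => f; apply/andP/imsetP => [[/chart_facetP[fs [i [b fE]]] vf]|].
    exists i => //; apply: chart_inj => //; rewrite fE hE; congr half_cube.
    move: vf; rewrite (le_half_cube vs fs fE) => /eqP vi.
    by case: (etrans (esym vi) (svalP (vbit i))).
  move=> [i _ ->]; split.
    by apply/chart_facetP; split=> //; exists i, (sval (vbit i)).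
  by rewrite (le_half_cube vs (hs i) (hE i)); apply/eqP/(svalP (vbit i)).
rewrite big_imset; last by move=> i j _ _; apply: hinj.
rewrite (eq_bigl xpredT); last by move=> i; rewrite inE.
by apply: eq_bigr => i _; apply: UF (hs i) (hE i) (svalP (vbit i)).
Qed.

Lemma cube_point_spread (U : X -> R) (u : 'I_n -> R) :
  (forall i f, (f <= s)%O -> phi f = half_cube i true -> U f = u i) ->
  (forall i f, (f <= s)%O -> phi f = half_cube i false -> U f = 1 - u i) ->
  cube_point s phi u = spread U s.
Proof.
move=> U1 U0; apply/funext => v; rewrite /cube_point /spread.
case: ifP => //= vs; case: ifPn => vv.
  symmetry; apply: prod_facets => // i [] f fs fE -> /=; [exact: U1|exact: U0].
move: vv; rewrite chart_vertex // negb_forall => /existsP[i].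
by rewrite negbK => /eqP vi; rewrite (bigD1 i) //= vi mul0r.
Qed.

(** The weights of a cube point are the terms of the expanded product of the
    sums [u i + (1 - u i)].  Restricting to the vertices of the face [f] selects
    one summand in each direction fixed by [f], and leaves the full sum 1 in
    the other directions. *)
Lemma mass_cube_point (u : 'I_n -> R) f : (f <= s)%O ->
  mass (cube_point s phi u) f =
  \prod_i match phi f i with Some true => u i | Some false => 1 - u i | None => 1 end.
Proof.
move=> fs.
pose W (o : option bool) (r : R) :=
  match o with Some true => r | Some false => 1 - r | None => 0 end.
transitivity (\prod_i \sum_(o | (phi f i == None) || (o == phi f i)) W o (u i)).
  rewrite bigA_distr_big_dep /mass.
  transitivity (\sum_(v | (v <= f)%O) \prod_i W (phi v i) (u i)).
    apply: eq_bigr => v vf; rewrite /cube_point (le_trans vf fs).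
    by apply: eq_bigr => i _.
  have hp a := cid2 (chart_surj a).
  pose psi a := s2val (hp a).
  have psis a : (psi a <= s)%O by rewrite /psi; case: (hp a).
  have psiK a : phi (psi a) = a by rewrite /psi; case: (hp a).
  rewrite (reindex_onto psi phi) /=; last first.
    by move=> v vf; apply: chart_inj => //; apply: le_trans fs.
  apply: eq_big => [a|a _]; last by rewrite psiK.
  by rewrite psiK eqxx andbT chart_le // psiK.
apply: eq_bigr => i _; case: (phi f i) => [b|] /=.
  by rewrite big_pred1_eq; case: b.
rewrite (bigD1 None) //= (bigD1 (Some true)) //= (bigD1 (Some false)) //=.
by rewrite big_pred0 => [|[[]|]] //=; rewrite addr0 add0r addrC subrK.
Qed.

End Chart.
End Charts.

(** * Chart-free description of closed cells *)

Section Cells.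
Context {d : Order.disp_t} {X : finPOrderType d} {R : realType}.
Implicit Types (x y s t v f : X) (w : {ptws X -> R}).

Lemma closed_cell_ge0 s w v : closed_cell s w -> 0 <= w v.
Proof.
move=> [n [phi [u [_ u01 ->]]]]; rewrite /cube_point; case: ifP => // _.
apply: prodr_ge0 => i _; have /andP[u0 u1] := u01 i.
by case: (phi v i) => [[]|] //; rewrite subr_ge0.
Qed.

Lemma closed_cell_support s w v : closed_cell s w -> ~~ (v <= s)%O -> w v = 0.
Proof.
by move=> [n [phi [u [_ _ ->]]]] /negPf vs; rewrite /cube_point vs.
Qed.

Lemma closed_cell_total s w : closed_cell s w -> mass w s = 1.
Proof.
move=> [n [phi [u [ch _ ->]]]]; rewrite (mass_cube_point ch) //.
by apply: big1 => i _; rewrite (chart_top ch).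
Qed.

(** A point of a cell is recovered from its own facet masses.  This is what makes
    closed cells independent of the chart that presents them. *)
Lemma closed_cell_spread s w : closed_cell s w -> w = spread (mass w) s.
Proof.
move=> [n [phi [u [ch _ ->]]]]; apply: (cube_point_spread ch) => i f fs fE;
  rewrite (mass_cube_point ch) // (bigD1 i) //= fE ffunE eqxx big1 ?mulr1 //
  => j /negPf ji; by rewrite ffunE ji.
Qed.

Lemma closed_cell_vertex s w v : closed_cell s w -> ~~ vertex v -> w v = 0.
Proof.
by move=> /closed_cell_spread -> /negPf vv; rewrite /spread vv andbF.
Qed.

Lemma mass_ge0 s w f : closed_cell s w -> 0 <= mass w f.
Proof. by move=> ws; apply: sumr_ge0 => v _; apply: closed_cell_ge0 ws. Qed.

Lemma mass_disjoint s w f : closed_cell s w ->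
  (forall x, ~ ((x <= f)%O /\ (x <= s)%O)) -> mass w f = 0.
Proof.
move=> ws dis; apply: big1 => v vf; apply: (closed_cell_support ws).
by apply/negP => vs; apply: (dis v).
Qed.

Lemma mass_le1 s w f : closed_cell s w -> mass w f <= 1.
Proof.
move=> ws; rewrite -(closed_cell_total ws) /mass big_mkcond [leRHS]big_mkcond.
apply: ler_sum => v _; case: ifP => vf; case: ifP => vs //.
  by rewrite (closed_cell_support ws) ?vs.
exact: closed_cell_ge0 ws.
Qed.

(** The weight is carried by vertices, and a vertex lies on exactly one of two
    opposite facets. *)
Lemma mass_opposite s w n (phi : X -> cube_face n) i f1 f0 :
  cube_chart s phi -> closed_cell s w -> (f1 <= s)%O -> (f0 <= s)%O ->
  phi f1 = half_cube i true -> phi f0 = half_cube i false ->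
  mass w f1 + mass w f0 = 1.
Proof.
move=> ch ws f1s f0s f1E f0E; rewrite -(closed_cell_total ws) /mass.
rewrite [LHS]addrC big_mkcond [X in _ + X]big_mkcond -big_split [RHS]big_mkcond /=.
apply: eq_bigr => v _; case: (boolP (v <= s)%O) => vs; last first.
  by rewrite (closed_cell_support ws vs) !if_same addr0.
rewrite (le_half_cube ch vs f1s f1E) (le_half_cube ch vs f0s f0E).
case vi: (phi v i) => [[]|]; rewrite ?add0r ?addr0 //.
rewrite (closed_cell_vertex ws) ?addr0 // (chart_vertex ch vs) negb_forall.
by apply/existsP; exists i; rewrite vi.
Qed.

(** Any chart can present a point of the cell: take as [i]-th coordinate the mass
    of the facet [1] in direction [i]. *)
Lemma closed_cell_chart s w n (phi : X -> cube_face n) :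
  cube_chart s phi -> closed_cell s w ->
  exists u : 'I_n -> R, (forall i, 0 <= u i <= 1) /\ w = cube_point s phi u.
Proof.
move=> ch ws.
have h1 i := cid2 (half_cube_ex ch i true); pose f1 i := s2val (h1 i).
have f1s i : (f1 i <= s)%O by rewrite /f1; case: (h1 i).
have f1E i : phi (f1 i) = half_cube i true by rewrite /f1; case: (h1 i).
exists (fun i => mass w (f1 i)); split=> [i|].
  by rewrite (mass_ge0 _ ws) (mass_le1 _ ws).
rewrite {1}(closed_cell_spread ws); symmetry.
apply: (cube_point_spread ch) => i f fs fE.
  by congr mass; apply: (chart_inj ch) => //; rewrite fE f1E.
by rewrite -(mass_opposite ch ws (f1s i) fs (f1E i) fE) addrAC subrr add0r.
Qed.

(** A chart of [s] yields one of a face [t], by keeping only the directions in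
    which [t] is free. *)
Section FaceChart.
Variables (s t : X) (n : nat) (phi : X -> cube_face n).
Hypotheses (ch : cube_chart s phi) (ts : (t <= s)%O).

Definition free_axis : pred 'I_n := fun i => phi t i == None.

Definition face_chart x : cube_face #|free_axis| :=
  [ffun k => phi x (enum_val k)].

Lemma face_chartP : cube_chart t face_chart.
Proof.
split=> [x y xt yt|a].
  have xs := le_trans xt ts; have ys := le_trans yt ts.
  rewrite (chart_le ch xs ys); apply/cube_face_leP/cube_face_leP => h.
    move=> i; case ti: (phi t i) => [b|].
      by right; rewrite (chart_le_Some ch xt ts ti) (chart_le_Some ch yt ts ti).
    have iJ : i \in free_axis by rewrite unfold_in /free_axis ti.
    by have := h (enum_rank_in iJ i); rewrite !ffunE enum_rankK_in.
  by move=> k; rewrite !ffunE.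
pose a' : cube_face n := [ffun i =>
  if [pick k : 'I_#|free_axis| | enum_val k == i] is Some k then a k else phi t i].
have [x xs xE] := chart_surj ch a'; exists x.
  rewrite (chart_le ch xs ts) xE; apply/cube_face_leP => i; rewrite ffunE.
  case: pickP => [k /eqP <-|_]; last by right.
  by left; apply/eqP; have := enum_valP k; rewrite unfold_in.
apply/ffunP => k; rewrite ffunE xE ffunE.
by case: pickP => [j /eqP/enum_val_inj ->//|/(_ k)]; rewrite eqxx.
Qed.

(** The directions fixed by [t] contribute only factors 1 at the vertices of [t],
    and at least one factor 0 at any other vertex. *)
Lemma cube_point_face (u : 'I_n -> R) :
  (forall i b, phi t i = Some b -> u i = b%:R) ->
  cube_point s phi u = cube_point t face_chart (fun k => u (enum_val k)).
Proof.
move=> ut; apply/funext => v; rewrite /cube_point.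
case: (boolP (v <= t)%O) => vt.
  rewrite (le_trans vt ts) (bigID free_axis) /= [X in _ * X]big1 ?mulr1.
    rewrite [LHS](big_enum_val (A := free_axis)) /=.
    by apply: eq_bigr => k _; rewrite ffunE.
  move=> i; rewrite /free_axis; case ti: (phi t i) => [b|] // _.
  rewrite (chart_le_Some ch vt ts ti) (ut _ _ ti).
  by case: b {ti} => //=; rewrite subr0.
case: ifP => // vs; move: vt; rewrite (chart_le ch vs ts) negb_forall.
case/existsP=> i; rewrite negb_or => /andP[ti vi].
rewrite (bigD1 i) //=; case tiE: (phi t i) ti vi => [b|] // _.
case: (phi v i) => [c|] => [|_]; last by rewrite mul0r.
rewrite (ut _ _ tiE); case: b {tiE}; case: c => //= _; first by rewrite subrr mul0r.
by rewrite mul0r.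
Qed.

Lemma face_closed_cell (u : 'I_n -> R) : (forall i, 0 <= u i <= 1) ->
  (forall i b, phi t i = Some b -> u i = b%:R) ->
  closed_cell t (cube_point s phi u).
Proof.
move=> u01 ut; exists #|free_axis|, face_chart, (fun k => u (enum_val k)).
by split; [exact: face_chartP|move=> k|exact: cube_point_face].
Qed.

Lemma closed_cell_sub_chart : @closed_cell _ _ R t `<=` closed_cell s.
Proof.
move=> w wt; have [u [u01 wE]] := closed_cell_chart face_chartP wt.
pose u' i := if [pick k : 'I_#|free_axis| | enum_val k == i] is Some k then u k
  else (phi t i == Some true)%:R.
exists n, phi, u'; split=> //.
  by move=> i; rewrite /u'; case: pickP => [k _|_] //; rewrite ler0n lern1 leq_b1.
rewrite cube_point_face.
  rewrite wE; congr cube_point; apply/funext => k; rewrite /u'.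
  by case: pickP => [j /eqP/enum_val_inj ->//|/(_ k)]; rewrite eqxx.
move=> i b ti; rewrite /u'; case: pickP => [k /eqP kE|_]; last first.
  by rewrite ti; case: b {ti}.
by have := enum_valP k; rewrite kE unfold_in /free_axis ti.
Qed.

End FaceChart.
End Cells.

(** * Pushing a cube away from a free face *)

Section Push.
Context {d : Order.disp_t} {X : finPOrderType d} {R : realType}.
Implicit Types (x y s v f sg ta : X) (w : {ptws X -> R}).

Definition touches f s := [exists x : X, (x <= f)%O && (x <= s)%O].
(** The push moves points of the cube [ta] away from a centre outside it, placed
    opposite the face [sg]: if [sg] is given by [u i = 0] for [i] in [F], the
    centre has coordinate [-1] for [i] in [F] and [1/2] in the directions free in
    [sg].  The number [pole sg f] is the mass of the facet [f] at this centre. *)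
Definition pole sg f : R :=
  if (sg <= f)%O then 2 else if touches f sg then 2^-1 else -1.
(** The ray from the centre through [w] leaves the cube when the mass of a facet
    touching [sg] vanishes.  At the point [(w - k * centre) / (1 - k)] of this ray the facet
    [f] has mass [(mass w f - k * pole sg f) / (1 - k)], so the exit point is
    reached at the least quotient [mass w f / pole sg f].  Since [ta] has a facet
    above [sg], where the quotient is at most [1/2], the default value [1/2] does
    not change the minimum on the cell, and it keeps [1 - k] positive
    everywhere. *)
Definition slack sg ta (w : X -> R) : R :=
  \big[Num.min/2^-1]_(f | facet ta f && touches f sg) (mass w f / pole sg f).
(** The facet masses at time [t] on the segment from [w] to its exit point. *)
Definition pushed sg ta (w : X -> R) (t : R) f : R :=
  mass w f + t * (slack sg ta w / (1 - slack sg ta w)) * (mass w f - pole sg f).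
Definition displacement sg ta (w : X -> R) (t : R) v : R :=
  spread (pushed sg ta w t) ta v - spread (mass w) ta v.

Lemma pole_gt0 sg f : touches f sg -> 0 < pole sg f.
Proof. by rewrite /pole => ->; case: ifP; rewrite ?invr_gt0 ltr0n. Qed.

Lemma slack_le_half sg ta w : slack sg ta w <= 2^-1.
Proof. exact: bigmin_le_id. Qed.

Lemma slack_le sg ta w f : facet ta f -> touches f sg ->
  slack sg ta w * pole sg f <= mass w f.
Proof.
move=> fa me; rewrite -ler_pdivlMr ?pole_gt0 //.
by apply: bigmin_le_cond; rewrite fa me.
Qed.

Lemma slack_ge0 s sg ta w : closed_cell s w -> 0 <= slack sg ta w.
Proof.
move=> ws; apply: le_bigmin => [|f /andP[_ me]]; first by rewrite invr_ge0.
by rewrite divr_ge0 ?(mass_ge0 _ ws) // ltW // pole_gt0.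
Qed.

Lemma displacement_time0 sg ta w v : displacement sg ta w 0 v = 0.
Proof.
rewrite /displacement (_ : pushed sg ta w 0 = mass w) ?subrr //.
by apply/funext => f; rewrite /pushed !mul0r addr0.
Qed.

Lemma displacement_slack0 sg ta w t v :
  slack sg ta w = 0 -> displacement sg ta w t v = 0.
Proof.
move=> k0; rewrite /displacement (_ : pushed sg ta w t = mass w) ?subrr //.
by apply/funext => f; rewrite /pushed k0 mul0r mulr0 mul0r addr0.
Qed.

Section Chart.
Variables (sg ta : X) (n : nat) (phi : X -> cube_face n).
Hypotheses (ch : cube_chart ta phi) (st : (sg < ta)%O).
Let sle : (sg <= ta)%O := ltW st.

(** A facet [u i = b] touches [s] unless [s] lies in the opposite facet. *)
Lemma touches_half_cube f s i b : (s <= ta)%O -> (f <= ta)%O ->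
  phi f = half_cube i b -> touches f s = (phi s i != Some (~~ b)).
Proof.
move=> ss fs fE; apply/existsP/idP => [[x /andP[xf xs]]|si].
  have xa := le_trans xs ss; move: xf; rewrite (le_half_cube ch xa fs fE) => /eqP xi.
  by apply/eqP => /(chart_le_Some ch xs ss); rewrite xi; case: (b).
pose a : cube_face n := [ffun j => if j == i then Some b else phi s j].
have [x xs xE] := chart_surj ch a; exists x.
rewrite (le_half_cube ch xs fs fE) xE ffunE !eqxx /= (chart_le ch xs ss) xE.
apply/cube_face_leP => j; rewrite ffunE; case: eqVneq => [->|_]; last by right.
case: (phi s i) si => [c|]; last by left.
by move=> h; right; congr Some; case: c b h {fE xE a} => [] [].
Qed.

Lemma pole_half_cube f i b : (f <= ta)%O -> phi f = half_cube i b ->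
  pole sg f = if phi sg i == Some b then 2
              else if phi sg i == Some (~~ b) then -1 else 2^-1.
Proof.
move=> fs fE; rewrite /pole (le_half_cube ch sle fs fE) (touches_half_cube sle fs fE).
by case: ifP => // _; case: eqP.
Qed.

Lemma pole_opposite f1 f0 i : (f1 <= ta)%O -> (f0 <= ta)%O ->
  phi f1 = half_cube i true -> phi f0 = half_cube i false ->
  pole sg f1 + pole sg f0 = 1.
Proof.
move=> f1s f0s f1E f0E; rewrite (pole_half_cube f1s f1E) (pole_half_cube f0s f0E).
by case: (phi sg i) => [[]|] /=; lra.
Qed.

Lemma slack_attained w : closed_cell ta w ->
  exists f, [/\ facet ta f, touches f sg & slack sg ta w * pole sg f = mass w f].
Proof.
move=> wt.
have [e|] : slack sg ta w = 2^-1 \/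
    exists f, [/\ facet ta f, touches f sg & slack sg ta w * pole sg f = mass w f].
- rewrite /slack; elim/big_ind: _ => [|x y hx hy|f /andP[fa me]]; first by left.
  + by rewrite minEle; case: ifP.
  + by right; exists f; rewrite divfK // gt_eqF // pole_gt0.
- have [i [b si]] := proper_face_axis ch st; have [f fs fE] := half_cube_ex ch i b.
  have sf : (sg <= f)%O by rewrite (le_half_cube ch sle fs fE) si.
  have fa : facet ta f by apply/(chart_facetP ch); split=> //; exists i, b.
  have me : touches f sg by rewrite (touches_half_cube sle fs fE) si; case: (b).
  exists f; split=> //; have := slack_le w fa me; rewrite e /pole sf.
  by have := mass_le1 f wt; lra.
- by [].
Qed.

(** The pushed mass is affine in [t], so it suffices to look at both ends.  The
    numerator of the final mass is nonnegative by minimality of the slack for a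
    facet that touches [sg], and because the centre has mass [-1] on the others. *)
Lemma pushed_ge0 w t f : closed_cell ta w -> 0 <= t <= 1 -> facet ta f ->
  0 <= pushed sg ta w t f.
Proof.
move=> wt /andP[t0 t1] fa; have k0 := slack_ge0 sg ta wt.
have k2 := slack_le_half sg ta w; have m0 := mass_ge0 f wt.
have kp : slack sg ta w * pole sg f <= mass w f.
  have [me|/negPf me] := boolP (touches f sg); first exact: slack_le.
  apply: le_trans m0; rewrite /pole me; case: ifP => [sf|_]; last lra.
  by move: me; suff -> : touches f sg by []; apply/existsP; exists sg; rewrite sf lexx.
have k1 : 0 < 1 - slack sg ta w by lra.
rewrite -(pmulr_rge0 _ k1) /pushed.
set k := slack sg ta w in k0 k2 kp k1 *; set m := mass w f in m0 kp *.
set p := pole sg f in kp *.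
have -> : (1 - k) * (m + t * (k / (1 - k)) * (m - p)) =
    (1 - t) * (1 - k) * m + t * (m - k * p) by field; rewrite gt_eqF.
by rewrite addr_ge0 // !mulr_ge0 // ?subr_ge0 //; lra.
Qed.

Lemma pushed_opposite w t f1 f0 i : closed_cell ta w ->
  (f1 <= ta)%O -> (f0 <= ta)%O ->
  phi f1 = half_cube i true -> phi f0 = half_cube i false ->
  pushed sg ta w t f1 + pushed sg ta w t f0 = 1.
Proof.
move=> wt f1s f0s f1E f0E; have := mass_opposite ch wt f1s f0s f1E f0E.
have := pole_opposite f1s f0s f1E f0E; rewrite /pushed.
move: (t * _) (mass w f1) (mass w f0) (pole sg f1) (pole sg f0) => l m1 m0 p1 p0 pE mE.
have -> : m0 = 1 - m1 by lra.
have -> : p0 = 1 - p1 by lra.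
by ring.
Qed.

Lemma cube_point_pushed w t : closed_cell ta w -> 0 <= t <= 1 ->
  exists u : 'I_n -> R, [/\ forall i, 0 <= u i <= 1,
    (fun v => w v + displacement sg ta w t v) = cube_point ta phi u &
    forall i b f, (f <= ta)%O -> phi f = half_cube i b ->
      pushed sg ta w t f = if b then u i else 1 - u i].
Proof.
move=> wt t01.
have h b i := cid2 (half_cube_ex ch i b); pose g b i := s2val (h b i).
have gs b i : (g b i <= ta)%O by rewrite /g; case: (h b i).
have gE b i : phi (g b i) = half_cube i b by rewrite /g; case: (h b i).
have gf b i : facet ta (g b i) by apply/(chart_facetP ch); split=> //; exists i, b.
pose u i := pushed sg ta w t (g true i); exists u.
have uE i b f : (f <= ta)%O -> phi f = half_cube i b ->
    pushed sg ta w t f = if b then u i else 1 - u i.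
  move=> fs fE; case: b fE => fE.
    by congr pushed; apply: (chart_inj ch) => //; rewrite fE gE.
  by rewrite -(pushed_opposite t wt (gs true i) fs (gE true i) fE) addrAC subrr add0r.
split=> // [i|].
  have := pushed_ge0 wt t01 (gf false i); rewrite (uE i false) //.
  by rewrite (pushed_ge0 wt t01 (gf true i)) subr_ge0.
rewrite (cube_point_spread ch (U := pushed sg ta w t)) => [|i f fs fE|i f fs fE].
- apply/funext => v; rewrite /displacement -(closed_cell_spread wt).
  by rewrite addrC subrK.
- by rewrite (uE i true).
- by rewrite (uE i false).
Qed.

Lemma push_in_cell w t : closed_cell ta w -> 0 <= t <= 1 ->
  closed_cell ta (fun v => w v + displacement sg ta w t v).
Proof.
move=> wt t01; have [u [u01 -> _]] := cube_point_pushed wt t01.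
by exists n, phi, u.
Qed.

(** At time 1 the facet that attains the minimum has mass 0, hence the point is in
    the opposite facet, and that one does not contain [sg]. *)
Lemma push_end w : closed_cell ta w ->
  exists f, [/\ (f <= ta)%O, ~~ (sg <= f)%O &
    closed_cell f (fun v => w v + displacement sg ta w 1 v)].
Proof.
move=> wt; have [f [fa me kE]] := slack_attained wt.
have [fs [i [b fE]]] := elimT (chart_facetP ch f) fa.
have [f' f's f'E] := half_cube_ex ch i (~~ b).
have t01 : 0 <= (1 : R) <= 1 by rewrite ler01 lexx.
have [u [u01 -> uE]] := cube_point_pushed wt t01.
exists f'; split=> //.
  by rewrite (le_half_cube ch sle f's f'E) -(touches_half_cube sle fs fE).
apply: (face_closed_cell ch) => // j c; rewrite f'E ffunE.
case: eqVneq => [->|//] [<-].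
have : pushed sg ta w 1 f = 0.
  have k2 := slack_le_half sg ta w.
  by rewrite /pushed -kE; field; rewrite gt_eqF //; lra.
by rewrite (uE i b f fs fE); case: (b) => /= h; lra.
Qed.

(** The push is stationary at a point of a cell [s] that does not contain [sg],
    whether or not that point belongs to [ta]: some facet of [ta] touches [sg]
    and misses the common face of [s] and [ta], hence has mass 0.  The push is
    thus given by one formula on the whole realization, and no pieces have to
    be glued. *)
Lemma slack_far s w : cubical_complex X -> closed_cell s w -> ~~ (sg <= s)%O ->
  slack sg ta w = 0.
Proof.
move=> [_ inter] ws nss.
have [f [fs me dis]] : exists f, [/\ facet ta f, touches f sg &
    forall x, ~ ((x <= f)%O /\ (x <= s)%O)].
  have [dis|[m mP]] := inter ta s.
    have [i [b si]] := proper_face_axis ch st; have [f fs fE] := half_cube_ex ch i b.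
    exists f; split; first by apply/(chart_facetP ch); split=> //; exists i, b.
      by rewrite (touches_half_cube sle fs fE) si; case: (b).
    by move=> x [xf xs]; apply: (dis x); split=> //; apply: le_trans xf fs.
  have [ma ms] : (m <= ta)%O /\ (m <= s)%O by apply/mP.
  have [i [b [mi si]]] : exists i b, phi m i = Some b /\ phi sg i != Some b.
    have : ~~ (sg <= m)%O by apply: contra nss => sm; apply: le_trans sm ms.
    rewrite (chart_le ch sle ma) negb_forall => /existsP[i].
    rewrite negb_or; case mi: (phi m i) => [b|//] /= si.
    by exists i, b.
  have [f fs fE] := half_cube_ex ch i (~~ b).
  exists f; split; first by apply/(chart_facetP ch); split=> //; exists i, (~~ b).
    by rewrite (touches_half_cube sle fs fE) negbK.
  move=> x [xf xs]; have xa := le_trans xf fs.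
  have xm : (x <= m)%O by apply/mP.
  move: xf; rewrite (le_half_cube ch xa fs fE) (chart_le_Some ch xm ma mi).
  by case: (b).
apply/le_anti; rewrite (slack_ge0 _ _ ws) andbT.
by rewrite -(pmulr_lle0 _ (pole_gt0 me)) -(mass_disjoint ws dis) slack_le.
Qed.

End Chart.
End Push.

(** * Continuity and equivariance of the push *)

Section RealFunctions.
Context {R : realType} {S : topologicalType}.
Implicit Types F G : S -> R.

Lemma continuousRM F G :
  continuous F -> continuous G -> continuous (fun p => F p * G p).
Proof. by move=> Fc Gc p; exact: (cvgM (Fc p) (Gc p)). Qed.

Lemma continuousRD F G :
  continuous F -> continuous G -> continuous (fun p => F p + G p).
Proof. by move=> Fc Gc p; exact: (cvgD (Fc p) (Gc p)). Qed.

Lemma continuousRB F G :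
  continuous F -> continuous G -> continuous (fun p => F p - G p).
Proof. by move=> Fc Gc p; exact: (cvgB (Fc p) (Gc p)). Qed.

Lemma continuousRV F : (forall p, F p != 0) ->
  continuous F -> continuous (fun p => (F p)^-1).
Proof. by move=> F0 Fc p; exact: (cvgV (F0 p) (Fc p)). Qed.

Lemma continuousRcst (a : R) : continuous (fun _ : S => a).
Proof. exact: cst_continuous. Qed.

Lemma continuousRmin F G :
  continuous F -> continuous G -> continuous (fun p => Num.min (F p) (G p)).
Proof. by move=> Fc Gc p; exact: (continuous_min (Fc p) (Gc p)). Qed.

Lemma continuousRmax F G :
  continuous F -> continuous G -> continuous (fun p => Num.max (F p) (G p)).
Proof. by move=> Fc Gc p; exact: (continuous_max (Fc p) (Gc p)). Qed.

End RealFunctions.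

Section Continuity.
Context {d : Order.disp_t} {X : finPOrderType d} {R : realType}.
Local Notation T := {ptws X -> R}.

Lemma continuous_ptws (S : topologicalType) (F : S -> T) :
  (forall v, continuous (fun p => F p v : R)) -> continuous F.
Proof.
move=> h p; apply/cvg_sup => v.
exact: (@continuous_comp_initial _ _ _ (fun w : X -> R => w v) F (h v)).
Qed.

Lemma continuous_eval v : continuous (fun p : T * R => p.1 v : R).
Proof.
move=> p; apply: (@continuous_comp _ _ _ (@fst T R) (fun w : T => w v)).
  exact: cvg_fst.
exact: (@proj_continuous X (fun=> R) v).
Qed.

Lemma continuous_bigR (op : R -> R -> R) x0 (I : Type) (r : seq I) (P : pred I)
  (F : I -> T * R -> R) : continuous (fun x : R * R => op x.1 x.2) ->
  (forall i, P i -> continuous (F i)) ->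
  continuous (fun p => \big[op/x0]_(i <- r | P i) F i p).
Proof. by move=> opc Fc; apply: (continuous_big opc). Qed.

Lemma continuous_mass f : continuous (fun p : T * R => mass p.1 f : R).
Proof.
rewrite /mass; apply: continuous_bigR => [|v _]; last exact: continuous_eval.
exact: add_continuous.
Qed.

Lemma continuous_spread (U : T * R -> X -> R) s v :
  (forall f, continuous (fun p => U p f)) ->
  continuous (fun p => spread (U p) s v : R).
Proof.
move=> Uc; rewrite /spread; case: ((v <= s)%O && vertex v); last exact: cst_continuous.
by apply: continuous_bigR => [|f _]; [exact: mul_continuous|exact: Uc].
Qed.

Lemma continuous_slack sg ta : continuous (fun p : T * R => slack sg ta p.1 : R).
Proof.
rewrite /slack; apply: continuous_bigR => [|f _].
  by apply: continuousRmin => x; [exact: cvg_fst|exact: cvg_snd].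
apply: continuousRM; [exact: continuous_mass|exact: continuousRcst].
Qed.

Lemma continuous_displacement sg ta v :
  continuous (fun p : T * R => displacement sg ta p.1 p.2 v : R).
Proof.
apply: continuousRB; last exact: (continuous_spread continuous_mass).
apply: continuous_spread => f; rewrite /pushed.
apply: continuousRD; first exact: continuous_mass.
apply: continuousRM; last first.
  by apply: continuousRB; [exact: continuous_mass|exact: continuousRcst].
apply: continuousRM; first by move=> p; exact: cvg_snd.
apply: continuousRM; first exact: continuous_slack.
apply: continuousRV => [p|].
  by have k2 := slack_le_half sg ta p.1; rewrite gt_eqF //; lra.
by apply: continuousRB; [exact: continuousRcst|exact: continuous_slack].
Qed.

(** Equivariance requires that all the cubes of an orbit be pushed together; at
    each point of the realization at most one summand will be nonzero. *)
Definition push_all (M : pred (X * X)) (p : T * R) : T := fun v =>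
  p.1 v + \sum_(c | M c) displacement c.1 c.2 p.1 p.2 v.

Lemma continuous_push_all M : continuous (push_all M).
Proof.
apply: continuous_ptws => v; apply: continuousRD; first exact: continuous_eval.
apply: continuous_bigR => [|c _]; first exact: add_continuous.
exact: continuous_displacement.
Qed.

Lemma push_all_time0 M w : push_all M (w, 0) = w.
Proof.
apply/funext => v; rewrite /push_all big1 /= ?addr0 // => c _.
exact: displacement_time0.
Qed.

End Continuity.

Section Equivariance.
Context {d : Order.disp_t} {X : finPOrderType d} {R : realType} {L : groupType}.
Variables (act : L -> X -> X).
Hypothesis hact : cubical_action act.
Implicit Types (g : L) (x y s f v : X) (w : {ptws X -> R}).

Lemma actK g : cancel (act g) (act g^-1%g).
Proof. by case: hact => a1 aM _ x; rewrite -aM mulVg a1. Qed.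

Lemma actVK g : cancel (act g^-1%g) (act g).
Proof. by case: hact => a1 aM _ x; rewrite -aM mulgV a1. Qed.

Lemma act_le g x y : (act g x <= act g y)%O = (x <= y)%O.
Proof. by case: hact. Qed.

Lemma act_bij g : bijective (act g).
Proof. exact: Bijective (actK g) (actVK g). Qed.

Lemma act_eq g x y : (act g x == act g y) = (x == y).
Proof. exact/inj_eq/bij_inj/act_bij. Qed.

Lemma act_lt g x y : (act g x < act g y)%O = (x < y)%O.
Proof. by rewrite !lt_neqAle act_le act_eq. Qed.

Lemma act_forall g (P : pred X) : [forall x, P x] = [forall x, P (act g x)].
Proof.
apply/forallP/forallP => h x; first exact: h.
by rewrite -(actVK g x); apply: h.
Qed.

Lemma act_exists g (P : pred X) : [exists x, P x] = [exists x, P (act g x)].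
Proof. by rewrite -[LHS]negbK negb_exists (act_forall g) -negb_exists negbK. Qed.

Lemma act_vertex g v : vertex (act g v) = vertex v.
Proof.
by rewrite /vertex (act_forall g); apply: eq_forallb => x; rewrite act_le act_eq.
Qed.

Lemma act_facet g s f : facet (act g s) (act g f) = facet s f.
Proof.
rewrite /facet act_lt (act_forall g); congr (_ && _).
by apply: eq_forallb => x; rewrite !act_le !act_eq.
Qed.

Lemma act_touches g f s : touches (act g f) (act g s) = touches f s.
Proof.
by rewrite /touches (act_exists g); apply: eq_existsb => x; rewrite !act_le.
Qed.

Lemma act_pole g sg f : pole (act g sg) (act g f) = pole sg f :> R.
Proof. by rewrite /pole act_le act_touches. Qed.

Lemma act_mass g w f : mass (realized_action act g w) (act g f) = mass w f.
Proof.
rewrite /mass (reindex (act g)) /=; last exact/onW_bij/act_bij.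
by apply: eq_big => v; rewrite ?act_le // /realized_action actK.
Qed.

Lemma act_spread g (U U' : X -> R) s v : (forall f, U' (act g f) = U f) ->
  spread U' (act g s) (act g v) = spread U s v.
Proof.
move=> UE; rewrite /spread act_le act_vertex; case: ifP => // _.
rewrite (reindex (act g)) /=; last exact/onW_bij/act_bij.
by apply: eq_big => f; rewrite ?act_facet ?act_le.
Qed.

Lemma act_slack g sg ta w :
  slack (act g sg) (act g ta) (realized_action act g w) = slack sg ta w.
Proof.
rewrite /slack (reindex (act g)) /=; last exact/onW_bij/act_bij.
by apply: eq_big => f; rewrite ?act_facet ?act_touches // act_mass act_pole.
Qed.

Lemma act_displacement g sg ta w t v :
  displacement (act g sg) (act g ta) (realized_action act g w) t (act g v) =
  displacement sg ta w t v.
Proof.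
rewrite /displacement; congr (_ - _); apply: act_spread => f.
  by rewrite /pushed act_mass act_slack act_pole.
exact: act_mass.
Qed.

Lemma act_push_all (M : pred (X * X)) g w t :
  (forall x y, M (act g x, act g y) = M (x, y)) ->
  push_all M (realized_action act g w, t) =
  realized_action act g (push_all M (w, t)).
Proof.
move=> Minv; apply/funext => v; rewrite {2}/realized_action /push_all /=.
congr (_ + _); rewrite (reindex (fun c : X * X => (act g c.1, act g c.2))) /=.
  apply: eq_big => [[x y]|[x y] _] //=.
  by rewrite -{1}(actVK g v) act_displacement.
apply: onW_bij; exists (fun c : X * X => (act g^-1%g c.1, act g^-1%g c.2)) => -[x y] /=.
  by rewrite !actK.
by rewrite !actVK.
Qed.

End Equivariance.

(** * Composition of equivariant deformation retractions *)

Section Retracts.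
Context {R : realType} {T : topologicalType} {L : Type} (act : L -> T -> T).

(** Continuity, the initial condition and equivariance are imposed on the whole
    ambient space, so that retractions compose without pasting continuous maps
    along closed sets. *)
Definition retracts (A B : set T) : Prop :=
  exists H : T * R -> T,
    [/\ continuous H, forall x, H (x, 0) = x &
        forall g x t, H (act g x, t) = act g (H (x, t))] /\
    [/\ forall x t, B x -> 0 <= t <= 1 -> B (H (x, t)),
        forall x, B x -> A (H (x, 1)) &
        forall x t, A x -> 0 <= t <= 1 -> H (x, t) = x].

Lemma retracts_refl A : retracts A A.
Proof. by exists fst; split; split=> // p; exact: cvg_fst. Qed.

Lemma retracts_trans A B C : A `<=` B -> B `<=` C ->
  retracts A B -> retracts B C -> retracts A C.
Proof.
move=> AB BC [H2 [[c2 z2 e2] [B2 A2 f2]]] [H1 [[c1 z1 e1] [B1 A1 f1]]].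
pose a (t : R) := Num.min (2 * t) 1; pose b (t : R) := Num.max (2 * t - 1) 0.
(* At each time at least one of the two homotopies is at an end: [b t = 0]
   during the first half, and [a t = 1] during the second. *)
exists (fun p => H2 (H1 (p.1, a p.2), b p.2)).
have Ha t : 0 <= t <= 1 -> 0 <= a t <= 1.
  by move=> /andP[t0 t1]; rewrite /a le_min ge_min lexx orbT ler01 !andbT; lra.
have Hb t : 0 <= t <= 1 -> 0 <= b t <= 1.
  by move=> /andP[t0 t1]; rewrite /b le_max ge_max lexx orbT ler01 !andbT /=; lra.
have a1 : a 1 = 1 by rewrite /a min_r //; lra.
have b1 : b 1 = 1 by rewrite /b max_l //; lra.
split; split.
- have ca : continuous a.
    apply: continuousRmin; last exact: continuousRcst.
    by apply: continuousRM; [exact: continuousRcst|move=> t; exact: cvg_id].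
  have cb : continuous b.
    apply: continuousRmax; last exact: continuousRcst.
    apply: continuousRB; last exact: continuousRcst.
    by apply: continuousRM; [exact: continuousRcst|move=> t; exact: cvg_id].
  have pairc (S : topologicalType) (F : S -> T) (G : S -> R) :
      continuous F -> continuous G -> continuous (fun p => (F p, G p)).
    by move=> Fc Gc p; exact: (cvg_pair (Fc p) (Gc p)).
  have compc (H : T * R -> T) (F : T * R -> T) (r : R -> R) : continuous H ->
      continuous F -> continuous r -> continuous (fun p => H (F p, r p.2)).
    move=> Hc Fc rc; have r2c : continuous (fun p : T * R => r p.2).
      by move=> p; apply: (@continuous_comp _ _ _ snd r); [exact: cvg_snd|exact: rc].
    move=> p; apply: (@continuous_comp _ _ _ (fun p => (F p, r p.2)) H); last exact: Hc.
    exact: pairc.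
  apply: (compc) => //; apply: (compc) => //.
  by move=> p; exact: cvg_fst.
- by move=> x /=; rewrite /a /b mulr0 min_l ?ler01 // sub0r max_r ?z2 ?z1 // lerN10.
- by move=> g x t /=; rewrite e1 e2.
- move=> x t Cx t01 /=; have [le|lt] := leP (2 * t) 1.
    by rewrite /b max_r ?z2; [apply: B1 => //; apply: Ha|lra].
  have at1 : a t = 1 by rewrite /a min_r // ltW.
  rewrite at1; apply/BC/B2; [exact: A1|exact: Hb].
- by move=> x Cx /=; rewrite a1 b1; apply/A2/A1.
- by move=> x t Ax t01 /=; rewrite f1 ?f2 //; [exact: Hb|exact: AB|exact: Ha].
Qed.

End Retracts.
Arguments retracts R {T L} act A B.

(** * Free classes of a Morse matching *)

Lemma iter_cycle (T : finType) (f : T -> T) x :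
  exists i k, (0 < k)%N /\ iter k f (iter i f x) = iter i f x.
Proof.
have /trajectP[i lt_i iE] := looping_order f x.
exists i, (fingraph.order f x - i)%N; rewrite subn_gt0; split=> //.
by rewrite -iterD subnK // ltnW.
Qed.

Section Matching.
Context {d : Order.disp_t} {X : finPOrderType d} (sim : rel X).
Hypothesis hsim : gen_morse_matching sim.
Implicit Types (x y z : X) (c : X * X).

Let eqv : equivalence_rel sim. Proof. by case: hsim. Qed.

Lemma sim_refl x : sim x x.
Proof. by case: (eqv x x x). Qed.

Lemma sim_congr x y z : sim x y -> sim x z = sim y z.
Proof. by case: (eqv x y z) => _; apply. Qed.

Lemma sim_sym x y : sim x y = sim y x.
Proof.
by apply/idP/idP => h; rewrite -(sim_congr _ h); apply: sim_refl.
Qed.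

Definition is_class c : Prop := forall y, sim c.1 y = (c.1 <= y <= c.2)%O.

(** Two classes with a common element are equal, and an interval determines its
    end points. *)
Lemma is_class_eq c c' x : is_class c -> is_class c' ->
  (c.1 <= x <= c.2)%O -> (c'.1 <= x <= c'.2)%O -> c = c'.
Proof.
move=> cP cP' cx cx'.
have E y : (c.1 <= y <= c.2)%O = (c'.1 <= y <= c'.2)%O.
  by rewrite -cP -cP' (@sim_congr c.1 x) ?cP // (@sim_congr c'.1 x) ?cP'.
have /andP[c12 c12'] : (c.1 <= c.2)%O && (c'.1 <= c'.2)%O.
  case/andP: cx => h1 h2; case/andP: cx' => h3 h4.
  by rewrite (le_trans h1 h2) (le_trans h3 h4).
have := E c.1; have := E c.2; have := E c'.1; have := E c'.2.
rewrite !lexx c12 c12' /= => /andP[_ h1] /andP[h2 _] /esym/andP[_ h3] /esym/andP[h4 _].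
by rewrite [c]surjective_pairing [c']surjective_pairing; congr pair;
  apply/le_anti; rewrite ?h1 ?h2 ?h3 ?h4.
Qed.

Lemma class_ex x : exists2 c, is_class c & (c.1 <= x <= c.2)%O.
Proof.
have [_ itv _] := hsim; have [s [t E]] := itv x.
have E' y : sim x y = (s <= y <= t)%O.
  have h : [set y | sim x y] y = cell_interval s t y by rewrite E.
  by rewrite /cell_interval /= in h; apply/idP/idP; rewrite h.
have sxt : (s <= x <= t)%O by rewrite -E' sim_refl.
exists (s, t) => // y /=; rewrite -E'; apply: sim_congr; rewrite sim_sym E' lexx.
by case/andP: sxt => /le_trans; apply.
Qed.

Lemma critical_class c x : is_class c -> (c.1 <= x <= c.2)%O ->
  critical sim x <-> c.1 = c.2.
Proof.
move=> cP cx; have xE y : sim x y = (c.1 <= y <= c.2)%O.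
  by rewrite -cP; apply: sim_congr; rewrite sim_sym cP.
have [c1x xc2] := andP cx; have c12 := le_trans c1x xc2.
split=> [crit|e].
  have xonly y : sim x y -> y = x.
    by move=> h; have : [set y | sim x y] y by []; rewrite crit.
  transitivity x; first by apply: xonly; rewrite xE lexx c12.
  by symmetry; apply: xonly; rewrite xE lexx c12.
rewrite /critical; apply/seteqP; split=> y /=.
  rewrite xE -e => /andP[h1 h2]; have h := le_anti (introT andP (conj h2 h1)).
  by rewrite h; apply/le_anti; rewrite c1x e xc2.
by move=> ->; apply: sim_refl.
Qed.

Section Action.
Context {L : groupType} (act : L -> X -> X).
Hypotheses (hact : cubical_action act) (heq : equivariant_rel act sim).
Hypothesis hU : subcomplex (critical sim).

Lemma act_sim g x y : sim (act g x) (act g y) = sim x y.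
Proof.
apply/idP/idP => [h|]; last exact: heq.
by have := heq g^-1%g h; rewrite !(actK hact).
Qed.

Lemma act_is_class g c : is_class c -> is_class (act g c.1, act g c.2).
Proof.
by move=> cP y /=; rewrite -(actVK hact g y) act_sim cP !(act_le hact).
Qed.

(** The subcomplexes reached while collapsing [X] onto the critical cells. *)
Record stage (Y : pred X) : Prop := Stage {
  stage_down : forall x y, (x <= y)%O -> Y y -> Y x;
  stage_sim : forall x y, sim x y -> Y x -> Y y;
  stage_act : forall g x, Y (act g x) = Y x;
  stage_critical : forall x, critical sim x -> Y x }.

(** A noncritical class [[c.1, c.2]] such that [c.2] is the only maximal cell of
    [Y] above [c.1]: it can be collapsed. *)
Definition free_class (Y : pred X) : pred (X * X) := fun c =>
  `[< [/\ is_class c, (c.1 < c.2)%O, Y c.2 &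
       forall y, Y y -> (c.1 <= y)%O -> (y <= c.2)%O] >].

Definition collapse (Y : pred X) : pred X := fun y =>
  Y y && ~~ [exists c, free_class Y c && (c.1 <= y <= c.2)%O].

Lemma free_class_above Y c y : free_class Y c -> Y y -> (c.1 <= y)%O ->
  (c.1 <= y <= c.2)%O.
Proof. by move=> /asboolP[_ _ _ h] Yy cy; rewrite cy h. Qed.

Lemma collapse_free Y c y : collapse Y y -> free_class Y c -> ~~ (c.1 <= y)%O.
Proof.
move=> /andP[Yy /existsPn/(_ c)] + cF; rewrite cF /=.
by apply: contra; exact: free_class_above cF Yy.
Qed.

Lemma act_free_class Y g x y : stage Y ->
  free_class Y (act g x, act g y) = free_class Y (x, y).
Proof.
move=> YS; have imp h a b : free_class Y (a, b) -> free_class Y (act h a, act h b).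
  move=> /asboolP[cP lt Yb mx]; apply/asboolP; split.
  - exact: (act_is_class h cP).
  - by rewrite /= (act_lt hact).
  - by rewrite /= (stage_act YS).
  - move=> z Yz /=; rewrite -(actVK hact h z) !(act_le hact); apply: mx.
    by rewrite (stage_act YS).
apply/idP/idP => [/(imp g^-1%g)|]; last exact: imp.
by rewrite !(actK hact).
Qed.

Lemma collapse_stage Y : stage Y -> stage (collapse Y).
Proof.
move=> YS; split.
- move=> x y xy Yy; have Yx := stage_down YS xy (proj1 (andP Yy)).
  rewrite /collapse Yx; apply/existsPn => c; apply/negP => /andP[cF /andP[cx _]].
  by have := collapse_free Yy cF; rewrite (le_trans cx xy).
- move=> x y xy /andP[Yx nx]; rewrite /collapse (stage_sim YS xy Yx).
  apply: contra nx => /existsP[c /andP[cF cy]]; apply/existsP; exists c.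
  rewrite cF /=; move: cF => /asboolP[cP _ _ _].
  by rewrite -cP (sim_sym c.1) (sim_congr _ xy) sim_sym cP.
- move=> g x; rewrite /collapse (stage_act YS); congr (_ && ~~ _).
  apply/existsP/existsP => -[c /andP[cF cx]].
    exists (act g^-1%g c.1, act g^-1%g c.2).
    rewrite act_free_class // -surjective_pairing cF /=.
    by rewrite -(act_le hact g _ x) -(act_le hact g x) !(actVK hact).
  exists (act g c.1, act g c.2).
  by rewrite act_free_class // -surjective_pairing cF /= !(act_le hact).
- move=> x xc; rewrite /collapse (stage_critical YS xc); apply/existsPn => c.
  apply/negP => /andP[/asboolP[cP lt _ _] cx].
  by move: lt; rewrite ((critical_class cP cx).1 xc) ltxx.
Qed.

(** If a noncritical class [[c.1, c.2]] is not free, then some cell above [c.1]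
    belongs to another class [[c'.1, c'.2]], which is noncritical because the
    critical cells form a subcomplex, and [c.1 < c'.2].  Were no class free,
    iterating this choice would close up by finiteness; read backwards, it is a
    cycle [c.1 < c.2 > ...] forbidden for a Morse matching. *)
Lemma free_class_exists Y x : stage Y -> Y x -> ~ critical sim x ->
  exists c, free_class Y c.
Proof.
move=> YS Yx xnc; apply: contrapT => nofree.
pose P c := [/\ is_class c, (c.1 < c.2)%O & Y c.2].
have class_P c y : is_class c -> (c.1 <= y <= c.2)%O -> Y y ->
    ~ critical sim y -> P c.
  move=> cP cy Yy ync; split=> //.
    rewrite lt_neqAle; case/andP: (cy) => /le_trans h /h ->; rewrite andbT.
    by apply/eqP => e; apply/ync/(critical_class cP cy).
  apply: (stage_sim YS _ Yy); rewrite -(@sim_congr c.1); first by rewrite cP lexx andbT;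
    case/andP: cy => /le_trans h /h.
  by rewrite cP.
have next c : P c -> exists c', [/\ P c', (c.1 < c'.2)%O & ~~ sim c'.2 c.1].
  move=> [cP lt Yc].
  have /existsNP[y /not_implyP[Yy /not_implyP[cy ync]]] :
      ~ forall y, Y y -> (c.1 <= y)%O -> (y <= c.2)%O.
    by move=> h; apply: nofree; exists c; apply/asboolP.
  have [c' cP' cy'] := class_ex y.
  have Pc' : P c'.
    apply: class_P cP' cy' Yy _ => yc; have := hU cy yc.
    move/(critical_class cP); rewrite lexx (ltW lt) => /(_ isT) e.
    by move: lt; rewrite e ltxx.
  have [y1 y2] := andP cy'; exists c'; split=> //.
    rewrite lt_neqAle (le_trans cy y2) andbT; apply/eqP => e.
    by apply: ync; rewrite (le_trans y2) // -e ltW.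
  apply/negP => s; apply: ync.
  suff : (c.1 <= y <= c.2)%O by case/andP.
  rewrite -cP -(sim_congr _ s) -(@sim_congr c'.1) ?cP' //.
  by rewrite lexx (le_trans y1 y2).
have [c0 cP0 cx0] := class_ex x; have Pc0 := class_P _ _ cP0 cx0 Yx xnc.
have next' c : {c' | P c -> [/\ P c', (c.1 < c'.2)%O & ~~ sim c'.2 c.1]}.
  by apply: cid; have [/next[c' h]|nP] := pselect (P c); [exists c'|exists c].
pose f c := sval (next' c).
have fP c : P c -> [/\ P (f c), (c.1 < (f c).2)%O & ~~ sim (f c).2 c.1].
  exact: svalP (next' c).
have Pit i : P (iter i f c0) by elim: i => //= i /fP[].
have [i [k [k0 kE]]] := iter_cycle f c0.
set c := iter i f c0 in kE; have Pc j : P (iter j f c) by rewrite -iterD.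
have csim j : sim (iter j f c).1 (iter j f c).2.
  by have [-> lt _] := Pc j; rewrite lexx ltW.
have [_ _] := hsim; apply; exists k.
(* The cycle runs against the iteration, as [c.1] lies under the top cell of the
   next class. *)
pose q (j : 'I_k) := iter (k - j.+1) f c.
have qS j : q j = f (q (ordS j)).
  rewrite /q /=; have := ltn_ord j; rewrite leq_eqVlt => /orP[/eqP e|lt].
    by rewrite e modnn -iterS subnSK // subnn subn0 kE.
  by rewrite modn_small // -iterS subnSK.
exists (fun j => (q j).1), (fun j => (q j).2); split.
  case: k k0 kE {q qS} => [//|[|//]] _ /= kE.
  by have [_ _] := fP _ (Pc 0%N); rewrite /= kE sim_sym (csim 0%N).
move=> j; have [_ lt ns] := fP _ (Pc (k - (ordS j).+1)%N).
rewrite -/(q (ordS j)) -qS in lt ns.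
by split=> //; [have [] := Pc (k - j.+1)%N|exact: csim].
Qed.

End Action.
End Matching.

(** * The retraction onto the critical cells *)

Section Collapse.
Context {R : realType} {L : groupType} {d : Order.disp_t} {X : finPOrderType d}.
Variables (act : L -> X -> X) (sim : rel X).
Hypotheses (hX : cubical_complex X) (hact : cubical_action act).
Hypotheses (hsim : gen_morse_matching sim) (heq : equivariant_rel act sim).
Hypothesis hU : subcomplex (critical sim).
Implicit Types (Y : pred X) (w : {ptws X -> R}) (x y s : X).

Local Notation stage := (stage sim act).
Local Notation body Y := (realization R [set x | Y x]).

Lemma displacement_far Y c w s t v : free_class sim Y c -> closed_cell s w ->
  ~~ (c.1 <= s)%O -> displacement c.1 c.2 w t v = 0.
Proof.
move=> /asboolP[_ lt _ _] ws far; have [n [phi ch]] := hX.1 c.2.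
exact/displacement_slack0/(slack_far ch lt hX ws far).
Qed.

Lemma push_all_far Y w s t : closed_cell s w ->
  (forall c, free_class sim Y c -> ~~ (c.1 <= s)%O) ->
  push_all (free_class sim Y) (w, t) = w.
Proof.
move=> ws far; apply/funext => v; rewrite /push_all big1 /= ?addr0 // => c cF.
exact: displacement_far cF ws (far c cF).
Qed.

(** Two free classes with bottoms below [s] both contain [s], hence coincide. *)
Lemma push_all_near Y c w s t : closed_cell s w -> Y s -> free_class sim Y c ->
  (c.1 <= s)%O ->
  push_all (free_class sim Y) (w, t) =
  (fun v => w v + displacement c.1 c.2 w t v).
Proof.
move=> ws Ys cF cs; apply/funext => v; rewrite /push_all (bigD1 c) //= big1 ?addr0 //.
move=> c' /andP[cF' ne]; apply: (displacement_far _ _ cF' ws).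
apply: contra ne => cs'; apply/eqP.
have [[cP _ _ _] [cP' _ _ _]] := (asboolW cF, asboolW cF').
apply: (is_class_eq hsim cP' cP (x := s)); first exact: free_class_above cF' _ _.
exact: free_class_above cF _ _.
Qed.

Lemma closed_cell_sub s s' : (s <= s')%O -> @closed_cell _ _ R s `<=` closed_cell s'.
Proof.
by move=> ss'; have [n [phi ch]] := hX.1 s'; exact: closed_cell_sub_chart ch ss'.
Qed.

(** A point moves only inside the top cell of a free class, and it ends in a face
    of this cell without the bottom cell.  That face survives the collapse: a
    free class containing it would also contain the top cell. *)
Lemma retracts_collapse Y : stage Y ->
  retracts R (realized_action act) (body (collapse sim Y)) (body Y).
Proof.
move=> YS; exists (push_all (free_class sim Y)).
have fixed w t s : collapse sim Y s -> closed_cell s w ->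
    push_all (free_class sim Y) (w, t) = w.
  by move=> Ys ws; apply: (push_all_far _ ws) => c; apply: collapse_free.
have cases w s : Y s -> closed_cell s w -> collapse sim Y s \/
    exists2 c, free_class sim Y c & (c.1 <= s)%O.
  move=> Ys ws; have [|] := boolP (collapse sim Y s); first by left.
  rewrite /collapse Ys negbK => /existsP[c /and3P[cF cs _]].
  by right; exists c.
split; split.
- exact: continuous_push_all.
- exact: push_all_time0.
- move=> g w t; apply: (act_push_all hact) => x y.
  exact: (act_free_class hact heq).
- move=> w t [s Ys ws] t01; have [Cs|[c cF cs]] := cases w s Ys ws.
    by rewrite (fixed w t s Cs ws); exists s.
  have [_ lt Yc _] := asboolW cF.
  have /andP[_ sc] := free_class_above cF Ys cs.
  have [n [phi ch]] := hX.1 c.2; exists c.2 => //.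
  by rewrite (push_all_near t ws Ys cF cs); apply: (push_in_cell ch lt _ t01);
    apply: (closed_cell_sub sc).
- move=> w [s Ys ws]; have [Cs|[c cF cs]] := cases w s Ys ws.
    by rewrite (fixed w 1 s Cs ws); exists s.
  have [cP lt Yc _] := asboolW cF.
  have /andP[_ sc] := free_class_above cF Ys cs.
  have [n [phi ch]] := hX.1 c.2.
  have [f [fc nf wf]] := push_end ch lt (closed_cell_sub sc ws).
  exists f; last by rewrite (push_all_near 1 ws Ys cF cs).
  rewrite /= /collapse (stage_down YS fc Yc); apply/existsPn => c'.
  apply/negP => /andP[cF' /andP[c'f _]].
  have [cP' _ _ _] := asboolW cF'.
  have E : c' = c.
    apply: (is_class_eq hsim cP' cP (x := c.2)); last by rewrite lexx (ltW lt).
    by apply: (free_class_above cF' Yc); apply: le_trans c'f fc.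
  by rewrite -E c'f in nf.
- by move=> w t [s Cs ws] _; apply: (fixed w t s).
Qed.

Lemma retracts_critical Y : stage Y ->
  retracts R (realized_action act) (realization R (critical sim)) (body Y).
Proof.
move: {2}_.+1 (ltnSn #|Y|) => n; elim: n Y => // n IH Y lt_n YS.
have [[x Yx xnc]|all_crit] := pselect (exists2 x, Y x & ~ critical sim x).
  have [c cF] := free_class_exists hsim hU YS Yx xnc.
  have CS := collapse_stage hsim hact heq YS.
  apply: (retracts_trans (B := body (collapse sim Y))); last exact: retracts_collapse.
  - by move=> w [s sc ws]; exists s => //; apply: stage_critical CS _ sc.
  - by move=> w [s /andP[Ys _] ws]; exists s.
  apply: (IH _ _ CS); rewrite -ltnS; apply: leq_trans lt_n; rewrite ltnS.
  apply: proper_card; apply/properP; split.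
    by apply/fintype.subsetP => y /andP[].
  have [_ lt Yc _] := asboolW cF; exists c.2 => //.
  rewrite unfold_in /= /collapse Yc /= negbK; apply/existsP; exists c.
  by rewrite cF /= lexx (ltW lt).
suff -> : critical sim = [set x | Y x] by apply: retracts_refl.
apply/seteqP; split=> x /=; first by move/(stage_critical YS).
by move=> Yx; apply: contrapT => xnc; apply: all_crit; exists x.
Qed.

End Collapse.

Theorem theorem2p3 (R : realType) (L : groupType) (d : Order.disp_t)
    (X : finPOrderType d) (act : L -> X -> X) (sim : rel X)
    (hX : cubical_complex X) (hact : cubical_action act)
    (hsim : gen_morse_matching sim) (heq : equivariant_rel act sim)
    (hU : subcomplex (critical sim)) :
  equivariant_strong_deformation_retract R (T := {ptws X -> R})
    (realized_action act)
    (realization R (critical sim)) (realization R [set: X]%classic).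
Proof.
have XS : stage sim act xpredT by [].
have allE : [set x : X | xpredT x]%classic = [set: X]%classic by apply/seteqP; split.
have := retracts_critical (R := R) hX hact hsim heq hU XS.
rewrite allE => -[H [[Hc H0 Heq] [HB HA Hfix]]].
split; first by move=> w [s _ ws]; exists s.
exists H; split=> //; first exact: continuous_subspaceT.
- by move=> w Bw; split; [exact: H0|exact: HA].
Qed.
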